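(* Let $n\ge 1$ be an odd integer with $3\nmid n$, and let $A$ be the adjacency matrix of the toroidal 3D queen graph $G_n$. Then for every $a\in(\mathbb{Z}_n)^3$, the character $\chi_a:(\mathbb{Z}_n)^3\to\mathbb{C}$, $\chi_a(x)=e^{2\pi i (a\cdot x)/n}$, is an eigenvector of $A$ with eigenvalue $$\lambda(a)=n\,\mu(a)-13 .$$
   Context: $\mathbb{Z}_n=\mathbb{Z}/n\mathbb{Z}$. Let $U$ be the set of the 13 integer vectors $$(1,0,0),(0,1,0),(0,0,1),(1,1,0),(1,-1,0),(1,0,1),(1,0,-1),(0,1,1),(0,1,-1),(1,1,1),(1,1,-1),(1,-1,1),(1,-1,-1),$$ one representative from each opposite pair in $\{-1,0,1\}^3\setminus\{0\}$. For $n$ odd with $3\nmid n$, the toroidal 3D queen graph $G_n$ is the simple undirected graph with vertex set $(\mathbb{Z}_n)^3$ in which two distinct vertices $x,y$ are adjacent if $y=x+tu$ in $(\mathbb{Z}_n)^3$ for some $u\in U$ and some $t\in\{1,\dots,n-1\}$. The dot product is $a\cdot x=a_1x_1+a_2x_2+a_3x_3$ modulo $n$ (with vectors of $U$ reduced modulo $n$). The orthogonality count of $a\in(\mathbb{Z}_n)^3$ is $\mu(a)=\#\{u\in U: a\cdot u\equiv 0 \pmod n\}$, where the 13 integer vectors of $U$ are counted individually. *)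

(* Defs.v *)
From HB Require Import structures.
From mathcomp Require Import all_boot all_order all_algebra.
From mathcomp Require Import reals topology normedtype sequences exp trigo.
From mathcomp.real_closed Require Import complex.
Set Implicit Arguments.
Unset Strict Implicit.
Unset Printing Implicit Defensive.
Import Order.TTheory GRing.Theory Num.Theory.
Local Open Scope ring_scope.

(* The ring Z/nZ for every n >= 1, including the zero ring for n = 1. The
   library's 'Z_n is not used because 'Z_1 denotes Z/2Z. When n = 0 the type
   below is Z/1Z, which is irrelevant. *)
Definition Zmod (n : nat) : Type := 'I_n.-1.+1.

HB.instance Definition _ (n : nat) := FinRing.Zmodule.on (Zmod n).
HB.instance Definition _ (n : nat) :=
  GRing.Zmodule_isComPzRing.Build (Zmod n) (@Zp_mulA _) (@Zp_mulC _)
    (@Zp_mul1z n.-1) (@Zp_mul_addl _).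

Lemma Zmod_mulrn (n : nat) (x : Zmod n) : (0 < n)%N -> x *+ n = 0.
Proof.
case: n x => // n x _; apply/val_inj.
by rewrite (congr1 val (Zp_mulrn (x : 'I_n.+1) n.+1)) /= modnMl.
Qed.

Definition vec3 (a b c : int) : 'rV[int]_3 := \row_(i < 3) [:: a; b; c]`_i.

(* Integer vectors, not their reductions: for n = 1 the 13 vectors coincide
   modulo n but [mu] below still counts each of them. *)
Definition U : seq 'rV[int]_3 :=
  [:: vec3 1 0 0; vec3 0 1 0; vec3 0 0 1;
      vec3 1 1 0; vec3 1 (-1) 0; vec3 1 0 1; vec3 1 0 (-1);
      vec3 0 1 1; vec3 0 1 (-1);
      vec3 1 1 1; vec3 1 1 (-1); vec3 1 (-1) 1; vec3 1 (-1) (-1)].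

Definition modv (n : nat) (u : 'rV[int]_3) : 'rV[Zmod n]_3 :=
  map_mx (fun z : int => z%:~R) u.

Definition queen_adj (n : nat) : rel 'rV[Zmod n]_3 := fun x y =>
  (x != y) &&
  has (fun u => [exists t : 'I_n, (0 < t)%N && (y == x + modv n u *+ t)]) U.

Lemma queen_adj_irr (n : nat) : irreflexive (@queen_adj n).
Proof. by move=> x; rewrite /queen_adj eqxx. Qed.

Lemma queen_adj_sym (n : nat) : symmetric (@queen_adj n).
Proof.
suff imp (x y : 'rV[Zmod n]_3) : queen_adj x y -> queen_adj y x.
  by move=> x y; apply/idP/idP; apply: imp.
case/andP=> neq_xy /hasP[u Uu /existsP[t /andP[t_gt0 /eqP Dy]]].
rewrite /queen_adj eq_sym neq_xy; apply/hasP; exists u => //.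
have n_gt0 : (0 < n)%N by apply: leq_ltn_trans (ltn_ord t).
have lt_nt : (n - t < n)%N by rewrite ltn_subrL t_gt0 n_gt0.
apply/existsP; exists (Ordinal lt_nt); rewrite /= subn_gt0 ltn_ord /=.
rewrite Dy -addrA -mulrnDr subnKC; last exact: ltnW.
suff -> : modv n u *+ n = 0 by rewrite addr0.
apply/rowP=> i; rewrite mulmxnE [RHS]mxE.
exact: Zmod_mulrn.
Qed.

Definition dot (n : nat) (a x : 'rV[Zmod n]_3) : Zmod n :=
  \sum_(i < 3) a 0 i * x 0 i.

Definition mu (n : nat) (a : 'rV[Zmod n]_3) : nat :=
  count (fun u => dot a (modv n u) == 0) U.

Definition cexp (R : realType) (z : R[i]) : R[i] :=
  Complex (expR (complex.Re z) * cos (complex.Im z))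
          (expR (complex.Re z) * sin (complex.Im z)).

(* The class of a.x modulo n is represented by its value in {0, ..., n-1}. *)
Definition chi (R : realType) (n : nat) (a x : 'rV[Zmod n]_3) : R[i] :=
  cexp (Complex 0 (2 * pi * (val (dot a x))%:R / n%:R)).

(* Functions and matrices on a finite type T are indexed by 'I_#|T| through
   the enumeration of T. *)
Definition adjmx (F : pzRingType) (T : finType) (e : rel T) : 'M[F]_#|T| :=
  \matrix_(i, j) (e (enum_val i) (enum_val j))%:R.

Definition colfun (F : Type) (T : finType) (f : T -> F) : 'cV[F]_#|T| :=
  \col_i f (enum_val i).

Definition is_eigenvector (F : fieldType) (m : nat) (A : 'M[F]_m)
    (v : 'cV[F]_m) (lambda : F) : Prop :=
  v != 0 /\ A *m v = lambda *: v.

(* Main.v *)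
(** For [n] odd, no two of the 13 lines through the origin share a nonzero
    point: if [s u = t v] modulo [n] with [u <> v] in [U], eliminating [t] shows
    that [s] times a 2x2 minor of [(u, v)] vanishes, and some minor is 1 or 2 up
    to sign, hence a unit modulo [n], so that [s = 0]. The neighbours of [x] are
    therefore the [x + t u] without repetition, and the sum of [chi_a] over them
    is [chi_a x] times the sum over [u] of the geometric sums of [chi_a(u)^t]
    for [0 < t < n], each equal to [n - 1] if [a.u = 0] and to [-1] otherwise. *)
Require Import Defs.
From mathcomp Require Import all_boot all_order all_algebra.
From mathcomp Require Import reals.
From mathcomp.real_closed Require Import complex.
From mathcomp Require Import exp trigo zify ring lra.
Import Order.TTheory GRing.Theory Num.Theory.
Local Open Scope ring_scope.

(** * Arithmetic modulo [n] and linearity of the dot product *)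

Lemma val_ZmodD (n : nat) (x y : Zmod n) :
  (0 < n)%N -> val (x + y) = ((val x + val y) %% n)%N.
Proof. by case: n x y. Qed.

Lemma val_Zmod_mulrn (n : nat) (x : Zmod n) (k : nat) :
  (0 < n)%N -> val (x *+ k) = ((val x * k) %% n)%N.
Proof.
by case: n x => // n x _; rewrite (congr1 val (Zp_mulrn (x : 'I_n.+1) k)).
Qed.

Lemma Zmod_natr_eq0 (n k : nat) :
  (0 < n)%N -> ((k%:R : Zmod n) == 0) = (n %| k)%N.
Proof.
move=> n_gt0; rewrite -val_eqE val_Zmod_mulrn //=.
case: n n_gt0 => // n _ /=.
by rewrite modnMml mul1n.
Qed.

Lemma Zmod_intr_eq0 (n : nat) (z : int) :
  (0 < n)%N -> ((z%:~R : Zmod n) == 0) = (n %| `|z|)%N.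
Proof.
move=> n_gt0; case: (intP z) => [|k|k]; rewrite ?eqxx ?dvdn0 //.
  by rewrite -Zmod_natr_eq0.
by rewrite mulrNz oppr_eq0 -Zmod_natr_eq0 // abszN.
Qed.

Lemma dotD (n : nat) (a x y : 'rV[Zmod n]_3) :
  dot a (x + y) = dot a x + dot a y.
Proof.
by rewrite /dot -big_split; apply: eq_bigr => i _; rewrite mxE mulrDr.
Qed.

Lemma dot_mulrn (n : nat) (a x : 'rV[Zmod n]_3) (k : nat) :
  dot a (x *+ k) = dot a x *+ k.
Proof.
elim: k => [|k IH]; last by rewrite !mulrS dotD IH.
by rewrite /dot big1 // => i _; rewrite mxE mulr0.
Qed.

(** * The 13 lines through the origin meet only at the origin *)

(* A copy of [U] with plain integer entries: matrix entries are locked, so the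
   finite checks below could not be run by computation on [U] itself. *)
Definition triples : seq (int * int * int) :=
  [:: (1, 0, 0); (0, 1, 0); (0, 0, 1);
      (1, 1, 0); (1, -1, 0); (1, 0, 1); (1, 0, -1);
      (0, 1, 1); (0, 1, -1);
      (1, 1, 1); (1, 1, -1); (1, -1, 1); (1, -1, -1)].

Definition vec_of (p : int * int * int) : 'rV[int]_3 :=
  vec3 p.1.1 p.1.2 p.2.

Lemma U_triples : U = map vec_of triples. Proof. by []. Qed.

Definition small_nonzero (z : int) : bool := (`|z| == 1)%N || (`|z| == 2)%N.

Definition has_small_minor (p q : int * int * int) : bool :=
  [|| small_nonzero (p.1.1 * q.1.2 - p.1.2 * q.1.1),
      small_nonzero (p.1.1 * q.2 - p.2 * q.1.1) |
      small_nonzero (p.1.2 * q.2 - p.2 * q.1.2)].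

Lemma triples_minor :
  all (fun p => all (fun q => (p == q) || has_small_minor p q) triples) triples.
Proof. by vm_compute. Qed.

Lemma triples_unit_coord :
  all (fun p => [|| `|p.1.1| == 1, `|p.1.2| == 1 | `|p.2| == 1]%N) triples.
Proof. by vm_compute. Qed.

Lemma triples_uniq : uniq triples. Proof. by vm_compute. Qed.

Lemma vec_of_inj : injective vec_of.
Proof.
move=> [[a b] c] [[a' b'] c'] /rowP E.
by move: (E 0) (E 1) (E (inord 2)); rewrite !mxE /= inordK // => /= -> -> ->.
Qed.

Lemma U_uniq : uniq U.
Proof. by rewrite U_triples (map_inj_uniq vec_of_inj) triples_uniq. Qed.

Lemma modv_mulrn_coords (n : nat) (p q : int * int * int) (s t : nat) :
  modv n (vec_of p) *+ s = modv n (vec_of q) *+ t ->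
  [/\ (p.1.1 * s%:Z - q.1.1 * t%:Z)%:~R = 0 :> Zmod n,
      (p.1.2 * s%:Z - q.1.2 * t%:Z)%:~R = 0 :> Zmod n &
      (p.2 * s%:Z - q.2 * t%:Z)%:~R = 0 :> Zmod n].
Proof.
move=> /rowP E; move: (E 0) (E 1) (E (inord 2)).
rewrite !mulmxnE !mxE /= inordK //= => E0 E1 E2.
by split; rewrite rmorphB /= !intrM -!pmulrn !mulr_natr (E0, E1, E2) subrr.
Qed.

(** Oddness of [n] makes 2 coprime to [n], so a minor equal to 1 or 2 up to sign can be
    cancelled. *)
Lemma small_nonzero_dvdn (n k : nat) (z : int) :
  odd n -> small_nonzero z -> (n %| `|(z * k%:Z)%R|)%N -> (n %| k)%N.
Proof.
move=> n_odd; rewrite abszM /= => /orP[] /eqP->; first by rewrite mul1n.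
by rewrite Gauss_dvdr // coprimen2.
Qed.

(** Only [s] has to be positive: the case [t = 0] serves later to show that a vertex is not its own
    neighbour. *)
Lemma modv_mulrn_inj (n : nat) (u v : 'rV[int]_3) (s t : nat) :
    odd n -> u \in U -> v \in U -> (0 < s < n)%N -> (t < n)%N ->
  modv n u *+ s = modv n v *+ t -> u = v /\ s = t.
Proof.
move=> n_odd; rewrite U_triples => /mapP[p Tp ->] /mapP[q Tq ->].
move=> /andP[s_gt0 ltsn] lttn /modv_mulrn_coords[].
have n_gt0 : (0 < n)%N by apply: leq_ltn_trans lttn.
have ndvd : ~~ (n %| s)%N by rewrite gtnNdvd.
have := allP (allP triples_minor p Tp) q Tq.
have [<- _ | _ /=] := eqVneq p q.
  (* On a common line, a coordinate of [p] equal to 1 or -1 gives [n] dividing [s - t], whose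
     absolute value is less than [n]. *)
  rewrite -!mulrBr => E0 E1 E2; split=> //.
  have: (n %| `|(s%:Z - t%:Z)%R|)%N.
    have dvd_unit (z : int) : (`|z| == 1)%N ->
        (z * (s%:Z - t%:Z))%:~R = 0 :> Zmod n -> (n %| `|(s%:Z - t%:Z)%R|)%N.
      by move=> /eqP z1 /eqP; rewrite Zmod_intr_eq0 // abszM z1 mul1n.
    by case/or3P: (allP triples_unit_coord p Tp) => /dvd_unit; apply.
  have [st|] := posnP `|(s%:Z - t%:Z)%R|; first by lia.
  by move=> d_gt0 /(dvdn_leq d_gt0); lia.
(* Eliminating [t] from two coordinates of [s p = t q] gives [s m = 0], where
   [m] is the corresponding minor of the matrix with rows [p] and [q]. *)
have elim_t (x x' y y' : int) : (x * s%:Z - x' * t%:Z)%:~R = 0 :> Zmod n ->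
    (y * s%:Z - y' * t%:Z)%:~R = 0 :> Zmod n ->
    small_nonzero (x * y' - y * x') -> False.
  move=> Ex Ey /small_nonzero_dvdn-/(_ n s n_odd) dvd_s.
  apply: (negP ndvd); apply: dvd_s; rewrite -Zmod_intr_eq0 //.
  have -> : (x * y' - y * x') * s%:Z =
    y' * (x * s%:Z - x' * t%:Z) - x' * (y * s%:Z - y' * t%:Z) by ring.
  by rewrite rmorphB /= !(intrM _ _ (_ - _)) Ex Ey !mulr0 subrr.
by move=> /or3P[] m E0 E1 E2; exfalso; apply: elim_t m.
Qed.

Arguments modv_mulrn_inj {n u v s t}.

(** Listing by line and step lets the sum over neighbours split into 13 geometric sums; absence of
    repetitions makes it agree with the sum over the adjacency relation. *)
Definition queen_nbrs (n : nat) (x : 'rV[Zmod n]_3) : seq 'rV[Zmod n]_3 :=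
  [seq x + modv n u *+ t | u <- U, t <- index_iota 1 n].

Lemma queen_nbrs_uniq (n : nat) (x : 'rV[Zmod n]_3) :
  odd n -> uniq (queen_nbrs n x).
Proof.
move=> n_odd; apply: allpairs_uniq; rewrite ?U_uniq ?iota_uniq //.
move=> _ _ /allpairsP[[u s] [Uu s_n ->]]
  /allpairsP[[v t] [Uv t_n ->]] /= /addrI.
move: s_n t_n; rewrite !mem_index_iota => s_n /andP[_ ltn_t].
by move=> /(modv_mulrn_inj n_odd Uu Uv s_n ltn_t)[/= -> ->].
Qed.

Lemma mem_queen_nbrs (n : nat) (x y : 'rV[Zmod n]_3) :
  odd n -> (y \in queen_nbrs n x) = queen_adj x y.
Proof.
move=> n_odd; apply/allpairsP/andP.
  move=> [[u t] [Uu]]; rewrite mem_index_iota => t_n Dy.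
  have [t_gt0 ltn_t] := andP t_n; split; last first.
    apply/hasP; exists u => //; apply/existsP; exists (Ordinal ltn_t).
    by rewrite /= t_gt0 Dy eqxx.
  (* If [y = x], then [t] and 0 give the same point of the line of [u], which forces [t = 0]. *)
  apply/eqP=> xy; have: modv n u *+ t = modv n u *+ 0.
    by apply: (addrI x); rewrite -Dy mulr0n addr0.
  have n_gt0 : (0 < n)%N by apply: leq_ltn_trans ltn_t.
  case/(modv_mulrn_inj n_odd Uu Uu t_n n_gt0) => _ t0.
  by rewrite t0 in t_gt0.
case=> _ /hasP[u Uu /existsP[t /andP[t_gt0 /eqP->]]].
by exists (u, val t); rewrite mem_index_iota t_gt0 ltn_ord.
Qed.

(** * Characters as powers of a primitive root of unity, and their sums along lines *)

Section Characters.
Variable R : realType.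

Definition cis (t : R) : R[i] := cexp (Complex 0 t).

Lemma cisD (s t : R) : cis (s + t) = cis s * cis t.
Proof.
rewrite /cis /cexp /= expR0 !mul1r cosD sinD.
by apply/eqP; rewrite eq_complex /= addrC (addrC (_ * _)) !eqxx.
Qed.

Lemma cis0 : cis 0 = 1.
Proof. by rewrite /cis /cexp /= expR0 !mul1r cos0 sin0. Qed.

Lemma cis_mulrn (t : R) (k : nat) : cis (t *+ k) = cis t ^+ k.
Proof.
by elim: k => [|k IH]; rewrite ?cis0 // mulrS exprS cisD IH.
Qed.

Lemma cis_2pi : cis (2 * pi) = 1.
Proof.
by rewrite /cis /cexp /= expR0 !mul1r mulr_natl cos2pi sin2pi.
Qed.

Lemma cis_neq1 (t : R) : 0 < t < 2 * pi -> cis t != 1.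
Proof.
move=> t_pi; rewrite /cis /cexp /= expR0 !mul1r eq_complex /= negb_and.
(* The real part differs from 1: [cos t = 1 - 2 sin^2 (t / 2)], with [t / 2] strictly between 0 and
   [pi]. *)
apply/orP; left; have sin_gt0 : 0 < sin (t / 2) by apply: sin_gt0_pi; lra.
have -> : t = (t / 2) *+ 2 by lra.
rewrite cos_mulr2n cos2sin2; have := mulr_gt0 sin_gt0 sin_gt0.
by rewrite -expr2 => sin2_gt0; rewrite lt_eqF //; lra.
Qed.

Definition zeta (n : nat) : R[i] := cis (2 * pi / n%:R).

Lemma zeta_prim (n : nat) : (0 < n)%N -> n.-primitive_root (zeta n).
Proof.
move=> n_gt0; have n_neq0 : n%:R != 0 :> R by rewrite pnatr_eq0 -lt0n.
rewrite /primitive_root_of_unity n_gt0; apply/forallP=> i; apply/eqP.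
rewrite unity_rootE -cis_mulrn -[_ *+ i.+1]mulr_natr.
have [->|neq_in] := eqVneq i.+1 n; first by rewrite divfK // cis_2pi eqxx.
apply/negbTE/cis_neq1; have lt_in : (i.+1 < n)%N.
  by rewrite ltn_neqAle neq_in ltn_ord.
have pi0 := pi_gt0 R.
rewrite mulrAC ltr_pdivrMr ?ltr0n // divr_gt0 ?mulr_gt0 ?ltr0n //=.
by rewrite ltr_pM2l ?mulr_gt0 // ltr_nat.
Qed.

Lemma chi_zeta (n : nat) (a x : 'rV[Zmod n]_3) :
  chi R a x = zeta n ^+ val (dot a x).
Proof. by rewrite /zeta -cis_mulrn -[_ *+ val _]mulr_natr mulrAC. Qed.

Variables (n : nat) (n_gt0 : (0 < n)%N).
Implicit Types a x y : 'rV[Zmod n]_3.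

Lemma chiD a x y : chi R a (x + y) = chi R a x * chi R a y.
Proof.
have prim := zeta_prim n n_gt0.
by rewrite !chi_zeta dotD val_ZmodD // (prim_expr_mod prim) exprD.
Qed.

Lemma chi_mulrn a x (k : nat) : chi R a (x *+ k) = chi R a x ^+ k.
Proof.
have prim := zeta_prim n n_gt0.
by rewrite !chi_zeta dot_mulrn val_Zmod_mulrn // (prim_expr_mod prim) exprM.
Qed.

Lemma chi_neq0 a x : chi R a x != 0.
Proof.
rewrite chi_zeta expf_neq0 //; apply: contraTneq isT => z0.
(* A zero [zeta n] would contradict its [n]-th power being 1. *)
have /eqP := prim_expr_order (zeta_prim n n_gt0).
by rewrite z0 expr0n gtn_eqF // eq_sym oner_eq0.
Qed.

Lemma chi_eq1 a x : (chi R a x == 1) = (dot a x == 0).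
Proof.
rewrite chi_zeta -(prim_order_dvd (zeta_prim n n_gt0)) -val_eqE /=.
have lt_dn : (val (dot a x) < n)%N.
  by case: n n_gt0 (dot a x) => // m _ d; apply: (ltn_ord (d : 'I_m.+1)).
have [->|d_gt0] := posnP (val (dot a x)); first by rewrite dvdn0.
by rewrite gtnNdvd // gtn_eqF.
Qed.

Lemma chi_order a x : chi R a x ^+ n = 1.
Proof.
by rewrite chi_zeta exprAC (prim_expr_order (zeta_prim n n_gt0)) expr1n.
Qed.

Lemma sum_chi_line a x :
  \sum_(1 <= t < n) chi R a x ^+ t = n%:R * (dot a x == 0)%:R - 1.
Proof.
(* Moving the [- 1] across supplies the missing term [t = 0]. The full sum has [n] terms equal to 1,
   or vanishes because its product with [chi R a x - 1] is [chi R a x ^+ n - 1 = 0]. *)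
apply/eqP; rewrite eq_sym subr_eq addrC eq_sym.
rewrite -[X in X + _](expr0 (chi R a x)) -big_ltn // big_mkord -chi_eq1.
have [->|neq1] := eqVneq (chi R a x) 1.
  rewrite (eq_bigr (fun=> 1)) => [|i _]; last by rewrite expr1n.
  by rewrite sumr_const card_ord mulr1.
have /esym/eqP := subrX1 (chi R a x) n.
by rewrite chi_order subrr mulf_eq0 subr_eq0 (negPf neq1) mulr0.
Qed.

Lemma sum_queen_nbrs a x :
  \sum_(y <- queen_nbrs n x) chi R a y =
    (n%:R * (mu a)%:R - 13%:R) * chi R a x.
Proof.
rewrite big_allpairs_dep /=.
transitivity
    (\sum_(u <- U) (n%:R * (dot a (modv n u) == 0)%:R - 1) * chi R a x).
  apply: eq_bigr => u _; rewrite -sum_chi_line mulr_suml.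
  by apply: eq_bigr => t _; rewrite chiD chi_mulrn mulrC.
(* The constant 13 is the size of [U]: each line contributes one [- 1]. *)
rewrite -mulr_suml sumrB -mulr_sumr big_const_seq count_predT iter_addr_0.
by rewrite -natr_sum /mu -sumn_count sumnE big_map.
Qed.

End Characters.

(** * From sums over neighbours to the matrix equation *)

Lemma adjmx_mul_colfun (F : pzRingType) (T : finType) (e : rel T) (f : T -> F)
    (i : 'I_#|T|) :
  (adjmx F e *m colfun f) i 0 = \sum_(y | e (enum_val i) y) f y.
Proof.
rewrite mxE [RHS]big_mkcond (reindex (@enum_val _ T)) /=.
  by apply: eq_bigr => j _; rewrite !mxE mulr_natl mulrb.
by apply: onW_bij; apply: enum_val_bij.
Qed.

Theorem theorem3p1 (R : realType) (n : nat) (n_ge1 : (1 <= n)%N)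
    (n_odd : odd n) (n_ndvd3 : ~~ (3 %| n)%N) (a : 'rV[Zmod n]_3) :
  is_eigenvector (adjmx R[i] (@queen_adj n)) (colfun (@chi R n a))
    (n%:R * (mu a)%:R - 13%:R).
Proof.
split.
  (* Any vertex would do here, since characters vanish nowhere; the origin is used. *)
  apply/negP => /eqP/colP/(_ (enum_rank (0 : 'rV[Zmod n]_3))).
  by rewrite !mxE => /eqP; apply/negP; exact: chi_neq0.
apply/colP=> i; rewrite adjmx_mul_colfun !mxE -sum_queen_nbrs //.
rewrite [RHS]big_uniq ?queen_nbrs_uniq //.
by apply: eq_bigl => y; rewrite mem_queen_nbrs.
Qed.
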